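(* Let $\alpha>0$, $\tau>0$ with $\alpha\tau<1$, and let $\sigma>0$. Let $a\in\mathbb R$ and let $V\in C^2(\mathbb R^n;[a,\infty))$ satisfy $\int_{\mathbb R^n}e^{-V(x)}\,\mathrm dx<\infty$. Let $x_a\in\mathbb R^n$ be a local minimum of $V$, let $x_b\in\mathbb R^n$, and let $\epsilon>0$ be small enough such that $\mathcal B_\epsilon(x_a)\cap\mathcal B_\epsilon(x_b)=\emptyset$. Let $\mathcal X(s)$ be the stochastic process generated by the rescaled approximating SDE $$\mathrm d\mathcal X=-\nabla V(\mathcal X)\,\mathrm ds-\alpha(\mathcal X-x_a)\,\mathrm ds+\frac{\sigma}{\sqrt{1-\alpha\tau}}\,\Sigma\,\mathrm dW(s),$$ where $W$ is a standard $m$-dimensional Wiener process ($m\geq n$) and $\Sigma\in\mathbb R^{n\times m}$ satisfies $\Sigma\Sigma^\top=I_n$. Let $$r_c(\epsilon,x_a,x_b):=\frac{\mathbb P(|\mathcal X-x_b|\le\epsilon)}{\mathbb P(|\mathcal X-x_a|\le\epsilon)},$$ where the probabilities are taken with respect to the stationary density $p_0$ of this SDE. Then $$r_c(\epsilon,x_a,x_b)\le\exp\left[\frac{\delta V(\epsilon,x_a,x_b)}{\tilde\nu}+\frac{\epsilon^2}{\beta^2}-\frac{\min_{x\in\mathcal B_\epsilon(x_b)}|x-x_a|^2}{\beta^2}\right],$$ where $$\delta V(\epsilon,x_a,x_b):=\max_{x\in\mathcal B_\epsilon(x_a)}V(x)-\min_{x\in\mathcal B_\epsilon(x_b)}V(x),\qquad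 \beta=\frac{\sigma}{\sqrt{\alpha(1-\alpha\tau)}},\qquad \tilde\nu=\frac{\sigma^2}{2(1-\alpha\tau)}.$$
   Context: $|\cdot|$ is the Euclidean norm and $\mathcal B_\epsilon(x_0)=\{x\in\mathbb R^n:|x-x_0|\le\epsilon\}$ is the closed ball. $V$ has a finite number of local minima, one of which is $x_a$; $x_b$ need not be an equilibrium. The effective potential is $\widetilde V(x):=V(x)+\frac{\alpha}{2}|x-x_a|^2$. The stationary density of the SDE is the (unique) probability density $p_0$ solving the stationary Fokker--Planck equation $\nabla\cdot[\nabla\widetilde V\,p_0]+\tilde\nu\Delta p_0=0$, which under the stated assumptions is known to be $$p_0(x)=C\exp\left[-\frac{\widetilde V(x)}{\tilde\nu}\right],\qquad C=\left[\int_{\mathbb R^n}\exp\left(-\frac{\widetilde V(x)}{\tilde\nu}\right)\mathrm dx\right]^{-1},\qquad \tilde\nu=\frac{\sigma^2}{2(1-\alpha\tau)}.$$ Thus $\mathbb P(\mathcal X\in\mathcal S)=\int_{\mathcal S}p_0(x)\,\mathrm dx$ for every Lebesgue-measurable $\mathcal S\subset\mathbb R^n$. *)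

(* Defs.v *)
From HB Require Import structures.
From mathcomp Require Import all_boot all_order all_algebra.
From mathcomp Require Import all_classical all_reals all_analysis.

Set Implicit Arguments.
Unset Strict Implicit.
Unset Printing Implicit Defensive.

Import Order.TTheory GRing.Theory Num.Theory.
Import numFieldNormedType.Exports.

Local Open Scope classical_set_scope.
Local Open Scope ring_scope.

Definition rV_display : measure_display.
Proof. exact: default_measure_display. Qed.

(* 'rV[R]_n carries the sigma-algebra generated by the coordinate maps, R having
   its Borel sigma-algebra; for finite n this is the Borel sigma-algebra of the
   product topology. *)
Section measurable_rV.
Context {R : realType} {n : nat}.

Definition rV_coor (i : 'I_n) (x : 'rV[R]_n) : measurableTypeR R := x ord0 i.

Let rV_set0 : g_sigma_preimage rV_coor set0.
Proof. exact: sigma_algebra0. Qed.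

Let rV_setC A : g_sigma_preimage rV_coor A -> g_sigma_preimage rV_coor (~` A).
Proof. exact: sigma_algebraC. Qed.

Let rV_bigcup (F : (set 'rV[R]_n)^nat) :
  (forall i, g_sigma_preimage rV_coor (F i)) ->
  g_sigma_preimage rV_coor (\bigcup_i (F i)).
Proof. exact: sigma_algebra_bigcup. Qed.

HB.instance Definition _ := @isMeasurable.Build rV_display
  'rV[R]_n (g_sigma_preimage rV_coor) rV_set0 rV_setC rV_bigcup.

Lemma measurable_rV_coor (i : 'I_n) : measurable_fun setT (rV_coor i).
Proof.
move=> _ Y mY; rewrite setTI; apply: sub_sigma_algebra => /=.
rewrite -bigcup_seq/=; exists i => /=; first by rewrite mem_index_enum.
by exists Y => //; rewrite setTI.
Qed.

Lemma measurable_fun_rV d (T : measurableType d) (f : T -> 'rV[R]_n) :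
  (forall i, measurable_fun setT (rV_coor i \o f)) -> measurable_fun setT f.
Proof.
move=> mf.
suff prefS : g_sigma_preimage (fun i => rV_coor i \o f) `<=` measurable.
  move=> _ A mA; apply: prefS; rewrite g_sigma_preimage_comp.
  by exists A.
apply: smallest_sub; first exact: sigma_algebra_measurable.
rewrite -bigcup_seq => B [i _ [C mC <-]].
exact: mf.
Qed.

End measurable_rV.

Section lebesgue_rV.
Context {R : realType}.

Definition rV_cons n (z : measurableTypeR R * 'rV[R]_n) : 'rV[R]_n.+1 :=
  row_mx (z.1)%:M z.2 : 'rV[R]_(1 + n).

Definition rV_uncons n (x : 'rV[R]_n.+1) : measurableTypeR R * 'rV[R]_n :=
  (x ord0 ord0, rsubmx (x : 'rV[R]_(1 + n))).

Lemma rV_consK n : cancel (@rV_cons n) (@rV_uncons n).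
Proof.
move=> [a x]; rewrite /rV_cons /rV_uncons /=; congr pair; last by rewrite row_mxKr.
have -> : @ord0 n = lshift n (@ord0 0) by exact/val_inj.
by apply: etrans (row_mxEl _ _ _ _) _; rewrite mxE eqxx mulr1n.
Qed.

Lemma rV_unconsK n : cancel (@rV_uncons n) (@rV_cons n).
Proof.
move=> x; rewrite /rV_cons /rV_uncons /=.
apply: etrans (@hsubmxK _ 1 1 n x); congr (@row_mx R 1 1 n _ _).
apply/matrixP => i j; rewrite !ord1 !mxE eqxx mulr1n.
by congr (x _ _); exact/val_inj.
Qed.

Lemma measurable_rV_cons n : measurable_fun setT (@rV_cons n).
Proof.
apply: measurable_fun_rV => i.
have [j ij|j ij] := @split_ordP 1 n i.
  rewrite (_ : _ \o _ = fst); first exact: measurable_fst.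
  apply/funext => -[a x] /=; rewrite /rV_coor /rV_cons /= ij.
  by apply: etrans (row_mxEl _ _ _ _) _; rewrite !ord1 mxE eqxx mulr1n.
rewrite (_ : _ \o _ = rV_coor j \o snd).
  apply: measurableT_comp; [exact: measurable_rV_coor|exact: measurable_snd].
apply/funext => -[a x] /=; rewrite /rV_coor /rV_cons /= ij.
exact: (@row_mxEr R 1 1 n).
Qed.

Lemma measurable_rV_uncons n : measurable_fun setT (@rV_uncons n).
Proof.
apply/measurable_fun_pairP; split; first exact: (measurable_rV_coor ord0).
apply: measurable_fun_rV => i.
rewrite (_ : _ \o _ = rV_coor (rshift 1 i : 'I_n.+1)).
  exact: measurable_rV_coor.
by apply/funext => x /=; rewrite /rV_coor /rV_uncons /= mxE.
Qed.

Section step.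
Variables (n : nat) (mu : {sigma_finite_measure set 'rV[R]_n -> \bar R}).

Definition lebesgue_rVS : set 'rV[R]_n.+1 -> \bar R :=
  pushforward (@lebesgue_measure R \x mu)%E (@rV_cons n).

Let lebesgue_rVS0 : lebesgue_rVS set0 = 0%E.
Proof. by rewrite /lebesgue_rVS /pushforward preimage_set0 measure0. Qed.

Let lebesgue_rVS_ge0 A : (0 <= lebesgue_rVS A)%E.
Proof. by rewrite /lebesgue_rVS /pushforward measure_ge0. Qed.

Let lebesgue_rVS_sigma_additive : semi_sigma_additive lebesgue_rVS.
Proof.
move=> F mF tF mUF; rewrite /lebesgue_rVS /pushforward preimage_bigcup.
have mcF k : measurable (@rV_cons n @^-1` F k).
  by rewrite -[X in measurable X]setTI; exact: measurable_rV_cons.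
apply: measure_semi_sigma_additive => //.
- by apply/trivIsetP => /= i j _ _ ij; rewrite -preimage_setI;
    move/trivIsetP : tF => /(_ _ _ _ _ ij) ->//; rewrite preimage_set0.
- by apply: bigcup_measurable => k _.
Qed.

HB.instance Definition _ := isMeasure.Build _ _ _ lebesgue_rVS
  lebesgue_rVS0 lebesgue_rVS_ge0 lebesgue_rVS_sigma_additive.

Let lebesgue_rVS_sigma_finite : sigma_finite setT lebesgue_rVS.
Proof.
have /sigma_finiteP[F [TF ndF Foo]] := sigma_finiteT (@lebesgue_measure R).
have /sigma_finiteP[G [TG ndG Goo]] := sigma_finiteT mu.
exists (fun k => @rV_uncons n @^-1` (F k `*` G k)).
  rewrite -preimage_bigcup (_ : \bigcup_k _ = setT) ?preimage_setT//.
  rewrite -setXTT TF TG predeqE => -[x y]; split.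
    by move=> [k _ []/= ? ?]; split; exists k.
  move=> [/= [k _ Fkx] [l _ Gly]]; exists (maxn k l) => //; split.
  - by move: x Fkx; exact/subsetPset/ndF/leq_maxl.
  - by move: y Gly; exact/subsetPset/ndG/leq_maxr.
move=> k; have [? ?] := Foo k; have [? ?] := Goo k; split.
  rewrite -[X in measurable X]setTI.
  by apply: measurable_rV_uncons => //; exact: measurableX.
rewrite /lebesgue_rVS /pushforward -comp_preimage.
rewrite (_ : _ \o _ = id); last by apply/funext => z /=; rewrite rV_consK.
by rewrite preimage_id product_measure1E// lte_mul_pinfty// ge0_fin_numE.
Qed.

HB.instance Definition _ := Measure_isSigmaFinite.Build _ _ _ lebesgue_rVS
  lebesgue_rVS_sigma_finite.

End step.

(* n-dimensional Lebesgue measure (on Borel sets): the n-fold product of the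
   one-dimensional one; in dimension 0, the unit mass at the only point. *)
Fixpoint lebesgue_rV (n : nat) : {sigma_finite_measure set 'rV[R]_n -> \bar R} :=
  match n with
  | 0 => @dirac _ 'rV[R]_0 (0 : 'rV[R]_0) R
  | n'.+1 => lebesgue_rVS (lebesgue_rV n')
  end.

Definition rV_box n (a b : 'rV[R]_n) : set 'rV[R]_n :=
  [set x | forall i, a ord0 i <= x ord0 i <= b ord0 i].

Lemma measurable_rV_box n (a b : 'rV[R]_n) : measurable (rV_box a b).
Proof.
rewrite (_ : rV_box a b = \big[setI/setT]_(i < n)
    (rV_coor i @^-1` [set` `[a ord0 i, b ord0 i]])).
  apply: bigsetI_measurable => i _; rewrite -[X in measurable X]setTI.
  by apply: measurable_rV_coor => //; exact: measurable_itv.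
rewrite -bigcap_seq; apply/seteqP; split => x /= h i.
  by move=> _; rewrite /= in_itv; exact: h.
by have := h i; rewrite /= in_itv; apply; rewrite mem_index_enum.
Qed.

Lemma lebesgue_rV_box n (a b : 'rV[R]_n) :
  (forall i, a ord0 i <= b ord0 i) ->
  lebesgue_rV n (rV_box a b) = (\prod_i (b ord0 i - a ord0 i))%:E.
Proof.
elim: n a b => [|n IHn] a b ab.
  by rewrite big_ord0 /= diracE mem_set// => -[].
pose a' : 'rV[R]_n := \row_i a ord0 (lift ord0 i).
pose b' : 'rV[R]_n := \row_i b ord0 (lift ord0 i).
have rV_cons0 (z : measurableTypeR R * 'rV[R]_n) : rV_cons z ord0 ord0 = z.1.
  exact: (congr1 fst (rV_consK z)).
have rV_consS (z : measurableTypeR R * 'rV[R]_n) i :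
    rV_cons z ord0 (lift ord0 i) = z.2 ord0 i.
  rewrite (_ : lift ord0 i = rshift 1 i); last exact/val_inj.
  exact: (@row_mxEr R 1 1 n).
rewrite /= /lebesgue_rVS /pushforward.
rewrite (_ : _ @^-1` _ = `[a ord0 ord0, b ord0 ord0] `*` rV_box a' b').
  rewrite product_measure1E//; last exact: measurable_rV_box.
  rewrite IHn; last by move=> i; rewrite !mxE.
  rewrite big_ord_recl EFinM; congr (_ * _)%E.
    apply: etrans (lebesgue_measure_itv _) _; rewrite /= lte_fin.
    case: ltP => // ba; apply/esym/eqP.
    by rewrite eqe subr_eq0 eq_le ba ab.
  by congr EFin; apply: eq_bigr => i _; rewrite !mxE.
apply/seteqP; split => [z /= h|z [/= h0 h] i].
  split => /=; first by rewrite in_itv/=; have := h ord0; rewrite rV_cons0.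
  by move=> i; rewrite !mxE; have := h (lift ord0 i); rewrite rV_consS.
have [j ->|->] := unliftP ord0 i.
  by rewrite rV_consS; have := h j; rewrite !mxE.
by rewrite rV_cons0; move: h0; rewrite in_itv.
Qed.

End lebesgue_rV.
Arguments lebesgue_rV {R} n.

Section euclidean.
Context {R : realType} {n : nat}.
Implicit Types (x : 'rV[R]_n) (f : 'rV[R]_n -> R).

(* The library norm `|x| on 'rV[R]_n is the sup norm. *)
Definition enorm x : R := Num.sqrt (\sum_i x ord0 i ^+ 2).

Definition eball x0 (eps : R) : set 'rV[R]_n :=
  [set x | enorm (x - x0) <= eps].

Definition partial (i : 'I_n) f : 'rV[R]_n -> R :=
  'D_(delta_mx ord0 i : 'rV[R]_n) f.

Definition grad f x : 'rV[R]_n := \row_i partial i f x.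

Fixpoint class_C (k : nat) f : Prop :=
  continuous f /\
  match k with
  | 0 => True
  | k'.+1 => forall i : 'I_n,
      (forall x, derivable f x (delta_mx ord0 i)) /\ class_C k' (partial i f)
  end.

Definition local_min f x0 : Prop := \forall x \near x0, f x0 <= f x.

(* The maximum (resp. minimum) of f on A, as an element of f @` A; the default
   value 0 is only returned when it is not attained, which does not happen for f
   continuous and A a closed ball. *)
Definition max_on (A : set 'rV[R]_n) f : R := xget 0 (f @` A `&` ubound (f @` A)).
Definition min_on (A : set 'rV[R]_n) f : R := xget 0 (f @` A `&` lbound (f @` A)).

End euclidean.

(* The autonomous SDE dX = b(X) ds + S dW with additive noise, where W is a
   standard m-dimensional Wiener process. The state is a row vector, whereas S
   keeps its usual n x m shape (it acts on columns). *)
Record sde (R : realType) (n m : nat) := SDE {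
  drift : 'rV[R]_n -> 'rV[R]_n;
  diffusion : 'M[R]_(n, m)
}.

Section stationary.
Context {R : realType} {n m : nat}.
Implicit Types (E : sde R n m) (p : 'rV[R]_n -> R).

(* - div (b p) + 1/2 sum_ij d_i d_j ((S S^T)_ij p) *)
Definition fokker_planck E p (x : 'rV[R]_n) : R :=
  - (\sum_i partial i (fun y => drift E y ord0 i * p y) x)
  + 2^-1 * \sum_i \sum_j partial i (partial j
      (fun y => (diffusion E *m (diffusion E)^T) i j * p y)) x.

Definition stationary_density E p : Prop :=
  [/\ class_C 2 p, forall x, 0 <= p x,
      (\int[lebesgue_rV n]_x (p x)%:E = 1)%E
    & forall x, fokker_planck E p x = 0].

(* P(X \in A) for a random vector X with density p *)
Definition prob p (A : set 'rV[R]_n) : R := \int[lebesgue_rV n]_(x in A) p x.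

End stationary.

Section rescaled_sde.
Context {R : realType} {n m : nat}.
Variables (alpha tau sigma : R) (V : 'rV[R]_n -> R) (xa : 'rV[R]_n).

Definition rescaled_sde (Sigma : 'M[R]_(n, m)) : sde R n m :=
  SDE (fun x => - grad V x - alpha *: (x - xa))
      ((sigma / Num.sqrt (1 - alpha * tau)) *: Sigma).

Definition nu_tilde : R := sigma ^+ 2 / (2 * (1 - alpha * tau)).

Definition beta : R := sigma / Num.sqrt (alpha * (1 - alpha * tau)).

Definition V_tilde (x : 'rV[R]_n) : R := V x + alpha / 2 * enorm (x - xa) ^+ 2.

End rescaled_sde.

Section rescaled_fokker_planck.
Context {R : realType} {n m : nat}.
Implicit Types (V p f : 'rV[R]_n -> R) (xa x : 'rV[R]_n).

Lemma partial_cst_mul (c : R) f (i : 'I_n) :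
  (forall x, derivable f x (delta_mx ord0 i)) ->
  partial i (fun y => c * f y) = (fun x => c * partial i f x).
Proof. by move=> df; apply/funext => x; rewrite /partial deriveZ. Qed.

Lemma is_derive_coor (j i : 'I_n) (x : 'rV[R]_n) :
  is_derive x (delta_mx ord0 i : 'rV[R]_n) (fun y : 'rV[R]_n => y ord0 j) ((i == j)%:R : R).
Proof.
have H : (fun h : R => h^-1 *: (((h *: (delta_mx ord0 i : 'rV[R]_n) + x) ord0 j : R) -
    x ord0 j)) @ 0^' --> ((i == j)%:R : R).
  apply: cvg_near_cst; near=> h.
  rewrite !mxE eqxx/= addrK eq_sym /GRing.scale/= mulrA mulVf ?mul1r//.
  by near: h; exact: nbhs_dnbhs_neq.
by split; [apply/cvg_ex; exists (i == j)%:R | exact/cvg_lim].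
Unshelve. all: by end_near. Qed.

Lemma is_derive_sqr_coor (j i : 'I_n) xa x :
  is_derive x (delta_mx ord0 i : 'rV[R]_n)
    (fun y : 'rV[R]_n => (y - xa) ord0 j ^+ 2)
    (2 * (x - xa) ord0 j * (i == j)%:R).
Proof.
have := is_derive_coor j i x.
move=> dj.
have -> : (fun y : 'rV[R]_n => (y - xa) ord0 j ^+ 2) =
    ((fun y : 'rV[R]_n => y ord0 j) - cst (xa ord0 j)) ^+ 2.
  by apply/funext => y; rewrite !mxE.
apply: is_derive_eq.
by rewrite subr0 !mxE /= expr1 /GRing.scale /= mulr_natl.
Qed.

Lemma is_derive_V_tilde alpha V xa (i : 'I_n) x :
  derivable V x (delta_mx ord0 i) ->
  is_derive x (delta_mx ord0 i : 'rV[R]_n) (V_tilde alpha V xa)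
    (partial i V x + alpha * (x - xa) ord0 i).
Proof.
move=> /derivableP dV.
have dS : is_derive x (delta_mx ord0 i : 'rV[R]_n)
    (\sum_(j < n) (fun y : 'rV[R]_n => (y - xa) ord0 j ^+ 2))
    (\sum_(j < n) (2 * (x - xa) ord0 j * (i == j)%:R)).
  by apply: is_derive_sum => j; exact: is_derive_sqr_coor.
have -> : V_tilde alpha V xa =
    V + (alpha / 2) *: (\sum_(j < n) (fun y : 'rV[R]_n => (y - xa) ord0 j ^+ 2)).
  apply/funext => y; rewrite /V_tilde /enorm sqr_sqrtr; last first.
    by apply: sumr_ge0 => j _; exact: sqr_ge0.
  by rewrite fctE /= fctE /= fct_sumE.
apply: is_derive_eq; congr (_ + _).
rewrite (bigD1 i)//= eqxx mulr1 big1 ?addr0; last first.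
  by move=> j ji; rewrite eq_sym (negbTE ji) mulr0.
by rewrite /GRing.scale /= mulrA divfK.
Qed.

(* The stationary Fokker-Planck equation of the rescaled SDE is
   div (p grad V_tilde) + nu_tilde Lap p = 0. *)
Lemma fokker_planck_rescaledE alpha tau sigma V xa (Sigma : 'M[R]_(n, m)) p x :
  alpha * tau < 1 -> class_C 2 V -> class_C 2 p -> Sigma *m Sigma^T = 1%:M ->
  fokker_planck (rescaled_sde alpha tau sigma V xa Sigma) p x =
  \sum_i partial i (fun y => partial i (V_tilde alpha V xa) y * p y) x +
  nu_tilde alpha tau sigma * \sum_i partial i (partial i p) x.
Proof.
move=> at1 [_ V2] [_ p2] SS.
have dVt (i : 'I_n) y : is_derive y (delta_mx ord0 i : 'rV[R]_n)
    (V_tilde alpha V xa) (partial i V y + alpha * (y - xa) ord0 i).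
  by apply: is_derive_V_tilde; have [] := V2 i.
rewrite /fokker_planck /=; congr (_ + _).
  rewrite -sumrN; apply: eq_bigr => i _.
  set g := fun y => _ * p y.
  have dg : derivable g x (delta_mx ord0 i).
    have dp : derivable p x (delta_mx ord0 i) by have [] := p2 i.
    have ddV : derivable (partial i V) x (delta_mx ord0 i).
      by have [_ [_ /(_ i)[]]] := V2 i.
    have dq : derivable (fun y : 'rV[R]_n => y ord0 i - xa ord0 i) x (delta_mx ord0 i).
      apply: derivableB; last exact: derivable_cst.
      by have [] := is_derive_coor i i x.
    rewrite (_ : g = (- (partial i V) - alpha *: (fun y => y ord0 i - xa ord0 i)) * p).
      apply: derivableM => //; apply: derivableB; first exact: derivableN.
      exact: derivableZ.
    by apply/funext => y; rewrite /g !mxE.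
  rewrite /partial -deriveN//; congr ('D_ _ _ _).
  apply/funext => y; have [_ ->] := dVt i y.
  by rewrite /g [LHS]/GRing.opp /= !mxE -opprD mulNr opprK.
have at0 : 0 < 1 - alpha * tau by rewrite subr_gt0.
have -> : (sigma / Num.sqrt (1 - alpha * tau) *: Sigma) *m
    (sigma / Num.sqrt (1 - alpha * tau) *: Sigma)^T =
    (sigma ^+ 2 / (1 - alpha * tau))%:M.
  rewrite -scalemxAl [X in _ *m X]linearZ/= -scalemxAr SS scalerA scale_scalar_mx mulr1.
  by rewrite mulrACA -expr2 -invfM -expr2 sqr_sqrtr// ltW.
rewrite /nu_tilde invfM (mulrCA _ 2^-1) -[RHS]mulrA; congr (_ * _).
rewrite mulr_sumr; apply: eq_bigr => i _.
rewrite (bigD1 i)//= big1 ?addr0 => [|j ji].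
  rewrite mxE eqxx mulr1n partial_cst_mul; last by have [] := p2 i.
  by rewrite partial_cst_mul//; have [_ [_ /(_ i)[]]] := p2 i.
rewrite mxE eq_sym (negbTE ji) mulr0n.
rewrite partial_cst_mul; last by have [] := p2 j.
rewrite partial_cst_mul ?mul0r//; by have [_ [_ /(_ i)[]]] := p2 j.
Qed.

End rescaled_fokker_planck.

Definition r_c {R : realType} {n : nat} (p0 : 'rV[R]_n -> R) (eps : R)
    (xa xb : 'rV[R]_n) : R :=
  prob p0 (eball xb eps) / prob p0 (eball xa eps).

Definition delta_V {R : realType} {n : nat} (V : 'rV[R]_n -> R) (eps : R)
    (xa xb : 'rV[R]_n) : R :=
  max_on (eball xa eps) V - min_on (eball xb eps) V.

(* Main.v *)
Require Import Defs.
From HB Require Import structures.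
From mathcomp Require Import all_boot all_order all_algebra.
From mathcomp Require Import all_classical all_reals all_analysis.
From mathcomp Require Import measurable_realfun ring lra.

(** The heart of the matter is that a stationary density is the Gibbs density
  [p = C w], where [w = exp (- U / nu)], [U] is the effective potential and [nu]
  the effective noise level. The density is only known to solve the stationary
  Fokker-Planck equation, and no growth condition bounds the gradient of [V], so
  uniqueness rests on a Liouville argument: on a complete space carrying a finite
  invariant measure, a positive harmonic function is constant.

  Concretely, the equation says that the flux [J = p grad U + nu grad p] is
  divergence free. With [q = w + p] and the bounded function [h = w / q] one
  computes [grad h = - k J], where [k = w / (nu q ^+ 2)]. Testing [div J = 0]
  against [m ^+ 2 * h], for a cutoff [m] at scale [K], gives the energy estimate
  [caccioppoli_estimate]: the integral of [m ^+ 2 * k * |J| ^+ 2] is at most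
  [16 nu / K ^+ 2] times the integral of [w]. The latter is finite, because [V] is
  bounded below and the quadratic term of [U] makes [w] decay like a Gaussian
  ([integrable_gibbs]). Letting [K] grow, [J = 0] ([flux_eq0_of_finite_mass]);
  hence [h] is constant and [p] is a multiple of [w] ([stationary_gibbs]). The
  estimate needs the divergence theorem for compactly supported fields only, and
  that follows from Fubini and the one-dimensional fundamental theorem of
  calculus ([integral_partial_compact_support]).

  The inequality is then elementary. On the ball around [xa] the potential [U] is
  at most [max V + alpha / 2 * eps ^+ 2]; on the ball around [xb] it is at least
  [min V + alpha / 2 * min |x - xa| ^+ 2]. Both balls have the same volume
  ([volume_eball]), so volume and normalisation cancel in the ratio, and
  [alpha / (2 nu) = 1 / beta ^+ 2]. *)

Set Implicit Arguments.
Unset Strict Implicit.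
Unset Printing Implicit Defensive.

Import Order.TTheory GRing.Theory Num.Theory.
Import numFieldNormedType.Exports.

Local Open Scope classical_set_scope.
Local Open Scope ring_scope.

(** * Borel sets of row vectors and translation invariance *)

Lemma rV_cons0 (R : realType) (n : nat) (z : measurableTypeR R * 'rV[R]_n) :
  rV_cons z ord0 ord0 = z.1.
Proof. exact: (congr1 fst (rV_consK z)). Qed.

Lemma rV_consS (R : realType) (n : nat) (z : measurableTypeR R * 'rV[R]_n)
    (i : 'I_n) : rV_cons z ord0 (lift ord0 i) = z.2 ord0 i.
Proof.
rewrite (_ : lift ord0 i = rshift 1 i); last exact/val_inj.
exact: (@row_mxEr R 1 1 n).
Qed.

Lemma rV_consD (R : realType) (n : nat) (z t : measurableTypeR R * 'rV[R]_n) :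
  rV_cons (z.1 + t.1 : R, z.2 + t.2) = rV_cons z + rV_cons t.
Proof.
apply/rowP => i; rewrite [RHS]mxE.
have [j ->|->] := unliftP ord0 i; last by rewrite !rV_cons0.
by rewrite !rV_consS mxE.
Qed.

(** An open set is the union of the closed rational boxes that it contains, and
  there are only countably many of these. *)
Lemma open_measurable_rV (R : realType) (n : nat) (U : set 'rV[R]_n) :
  open U -> measurable U.
Proof.
move=> oU.
pose box (q : 'rV[rat]_n * 'rV[rat]_n) :=
  rV_box (\row_i (ratr (q.1 ord0 i) : R)) (\row_i ratr (q.2 ord0 i)).
pose F q := if `[< box q `<=` U >] then box q else set0.
rewrite (_ : U = \bigcup_q F q).
  apply: countable_bigcupT_measurable => [|q].
    exact: (@countableP ('rV[rat]_n * 'rV[rat]_n)%type).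
  by rewrite /F; case: ifP => _; [exact: measurable_rV_box|exact: measurable0].
apply/seteqP; split => [x Ux|x [q _]]; last first.
  by rewrite /F; case: asboolP => // bU; exact: bU.
have [e /= e0 xe] : exists2 e : R, 0 < e & ball x e `<=` U.
  exact/nbhs_ballP/open_nbhs_nbhs.
have lo i : exists q : rat, ratr q \in `]x ord0 i - e, x ord0 i[.
  by apply: rat_in_itvoo; rewrite ltrBlDr ltrDl.
have hi i : exists q : rat, ratr q \in `]x ord0 i, x ord0 i + e[.
  by apply: rat_in_itvoo; rewrite ltrDl.
pose q := (\row_i sval (cid (lo i)), \row_i sval (cid (hi i))).
exists q => //; rewrite /F.
have xq : box q x.
  move=> i; rewrite !mxE; case: cid => /= qa; case: cid => /= qb.
  by rewrite !in_itv /= => /andP[/ltW-> _] /andP[_ /ltW->].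
case: asboolP => // h; exfalso; apply: h => y yq; apply: xe.
split=> // i j; rewrite ord1 /ball /=.
have := yq j; rewrite !mxE; case: cid => /= qa; case: cid => /= qb.
rewrite !in_itv /= => /andP[bx bxe] /andP[axe ax] /andP[ay yb].
rewrite ltr_distlC; apply/andP; split; first exact: lt_le_trans ay.
exact: le_lt_trans bxe.
Qed.

Lemma continuous_measurable_rV (R : realType) (n : nat) (f : 'rV[R]_n -> R) :
  continuous f -> measurable_fun setT f.
Proof.
move=> /continuousP cf; apply: (measurability _ (RGenOpens.measurableE R)).
move=> _ [_ [a [b ->]] <-]; rewrite setTI.
by apply: open_measurable_rV; apply: cf; exact: itv_open.
Qed.

Lemma lebesgue_measure_translate (R : realType) (c : R)
    (A : set (measurableTypeR R)) : measurable A ->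
  lebesgue_measure [set t : R | A (t + c)] = lebesgue_measure A.
Proof.
move=> mA.
have mf : measurable_fun setT
    (fun t : measurableTypeR R => t + c : measurableTypeR R).
  exact: measurable_funD.
pose f : {mfun measurableTypeR R >-> measurableTypeR R} :=
  HB.pack (fun t : measurableTypeR R => t + c : measurableTypeR R)
    (isMeasurableFun.Build _ _ _ _ _ mf).
apply/esym/(@lebesgue_measure_unique _
  (pushforward (@lebesgue_measure R) f)) => //= _ [[a b]] _ <-.
rewrite /pushforward (_ : _ @^-1` _ = `]a - c, b - c]%classic).
  rewrite !lebesgue_measure_itv /= !lte_fin ltrD2r.
  by case: ifP => // _; rewrite -!EFinD opprB addrA subrK.
by apply/seteqP; split=> t /=; rewrite !in_itv /= ltrBlDr lerBrDr.
Qed.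

(** In the induction step, the translate of the product measure agrees with the
  product measure on rectangles, which determine it. *)
Lemma lebesgue_rV_translate (R : realType) (n : nat) (c : 'rV[R]_n)
    (A : set 'rV[R]_n) : measurable A ->
  lebesgue_rV n [set x | A (x + c)] = lebesgue_rV n A.
Proof.
elim: n c A => [|n IHn] c A mA.
  by congr (lebesgue_rV 0 _); apply/funext => x /=; congr A; apply/rowP => -[].
pose c0 : R := c ord0 ord0; pose c' : 'rV[R]_n := (rV_uncons c).2.
have mg : measurable_fun setT
    (fun z : measurableTypeR R * 'rV[R]_n =>
      (z.1 + c0 : measurableTypeR R, z.2 + c')).
  apply/measurable_fun_pairP; split.
    rewrite (_ : _ \o _ = (fun t => t + c0) \o fst)//.
    by apply: measurable_funD => //; exact: measurable_fst.
  apply: measurable_fun_rV => i.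
  rewrite (_ : _ \o _ = (fun z => rV_coor i z.2 + c' ord0 i)); last first.
    by apply/funext => z; rewrite /rV_coor /= !mxE.
  apply: measurable_funD => //; apply: (measurableT_comp (measurable_rV_coor i)).
  exact: measurable_snd.
pose g0 (z : measurableTypeR R * 'rV[R]_n) : measurableTypeR R * 'rV[R]_n :=
  (z.1 + c0, z.2 + c').
pose g : {mfun (measurableTypeR R * 'rV[R]_n)%type >->
               (measurableTypeR R * 'rV[R]_n)%type} :=
  HB.pack g0 (isMeasurableFun.Build _ _ _ _ _ mg).
rewrite /= /lebesgue_rVS.
rewrite [RHS](@product_measure_unique _ _ _ _ _ _ _
  (pushforward (@lebesgue_measure R \x lebesgue_rV n)%E g)).
- rewrite /pushforward; congr (_ _); apply/funext => z /=; congr A.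
  by rewrite -[c in LHS]rV_unconsK -rV_consD.
- move=> B C mB mC; rewrite /= /pushforward.
  rewrite (_ : _ @^-1` _ = [set t : R | B (t + c0)] `*` [set x | C (x + c')])//.
  rewrite product_measure1E ?IHn//.
  + by congr (_ * _)%E; exact: lebesgue_measure_translate.
  + by rewrite -[X in measurable X]setTI; exact: measurable_funD.
  + suff m : measurable_fun setT (fun x : 'rV[R]_n => x + c').
      by rewrite -[X in measurable X]setTI; exact: m.
    apply: measurable_fun_rV => i.
    rewrite (_ : _ \o _ = (fun x => rV_coor i x + c' ord0 i)); last first.
      by apply/funext => x; rewrite /rV_coor /= !mxE.
    by apply: measurable_funD => //; exact: measurable_rV_coor.
- rewrite -[X in measurable X]setTI; exact: measurable_rV_cons.
Qed.

(** * The divergence theorem for compact support *)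

Lemma rV_lineE (R : realType) (n : nat) (h : R) (v x : 'rV[R]_n) (i : 'I_n) :
  (h *: v + x) ord0 i = h * v ord0 i + x ord0 i.
Proof. by rewrite !mxE. Qed.

(** Directional derivatives are derivatives of restrictions to lines; this brings
  the chain rule and the mean value theorem in several variables down to their
  one-dimensional versions. *)
Lemma is_derive_line (R : realType) (n : nat) (f : 'rV[R]_n -> R)
    (x v : 'rV[R]_n) (t d : R) :
  is_derive (t *: v + x) v f d <-> is_derive t (1 : R) (fun s => f (s *: v + x)) d.
Proof.
have E : (fun h : R => h^-1 *: (f (h *: v + (t *: v + x)) - f (t *: v + x))) =
    (fun h : R => h^-1 *: (((fun s : R => f (s *: v + x)) \o shift t) (h *: (1 : R))
        - f (t *: v + x))).
  apply/funext => h /=; congr (_ *: (f _ - _)).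
  by rewrite addrA scalerDl -[h *: 1]/(h * 1) mulr1.
have dE : derivable f (t *: v + x) v = derivable (fun s : R => f (s *: v + x)) t 1.
  exact: (congr1 (fun F : R -> R => cvg (F @ 0^')) E).
have DE : 'D_v f (t *: v + x) = 'D_1 (fun s : R => f (s *: v + x)) t.
  exact: (congr1 (fun F : R -> R => lim (F @ 0^')) E).
by split => -[d1 d2]; split; [rewrite -dE|rewrite -DE|rewrite dE|rewrite DE].
Qed.

Lemma is_derive_line0 (R : realType) (n : nat) (f : 'rV[R]_n -> R)
    (x v : 'rV[R]_n) (d : R) :
  is_derive x v f d <-> is_derive (0 : R) (1 : R) (fun s => f (s *: v + x)) d.
Proof. by rewrite -is_derive_line scale0r add0r. Qed.

Lemma integral_derive_compact_support (R : realType) (u du : R -> R) (K : R) :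
  (forall t, is_derive t (1 : R) u (du t)) -> continuous du ->
  (forall t, K < `|t| -> u t = 0 /\ du t = 0) ->
  (\int[@lebesgue_measure R]_t (du t)%:E = 0)%E.
Proof.
move=> dudu cdu u0; pose L := `|K| + 1.
have KL : K < L by rewrite /L (le_lt_trans (ler_norm K))// ltrDl.
have L0 : 0 < L by rewrite ltr_wpDl.
have du0 t : t \notin `[- L, L] -> du t = 0.
  move=> tL; apply: (u0 _ _).2; rewrite ltNge; apply: contra tL => tK.
  by rewrite in_itv /= -ler_norml (le_trans tK)// ltW.
rewrite (_ : (fun t => (du t)%:E) = (fun t => (du t)%:E) \_ `[- L, L]); last first.
  apply/funext => t; rewrite patchE; case: ifPn => // tL.
  by rewrite du0//; apply: contra tL; rewrite inE.
rewrite -integral_mkcond (@continuous_FTC2 _ du u (- L) L).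
- by rewrite (u0 L _).1 ?(u0 (- L) _).1 ?subee// ?normrN gtr0_norm.
- by rewrite gtrN.
- exact: continuous_subspaceT.
- have cu : continuous u.
    move=> t; apply/differentiable_continuous/derivable1_diffP.
    by have [] := dudu t.
  split=> [t _||]; first by have [] := dudu t.
    by apply: cvg_at_right_filter; exact: cu.
  by apply: cvg_at_left_filter; exact: cu.
- by move=> t _; rewrite derive1E; have [_ ->] := dudu t.
Qed.

Lemma rV_cons_line (R : realType) (n : nat) (t : R) (y : 'rV[R]_n) :
  rV_cons (t : measurableTypeR R, y) =
  t *: (delta_mx ord0 ord0) + rV_cons (0 : measurableTypeR R, y).
Proof.
apply/rowP => i; rewrite rV_lineE [X in _ * X + _]mxE eqxx /=.
have [j ->|->] := unliftP ord0 i; first by rewrite !rV_consS mulr0 add0r.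
by rewrite !rV_cons0 mulr1 addr0.
Qed.

Lemma rV_cons_delta (R : realType) (n : nat) (t h : R) (y : 'rV[R]_n) (j : 'I_n) :
  rV_cons (t : measurableTypeR R, h *: delta_mx ord0 j + y) =
  h *: (delta_mx ord0 (lift ord0 j)) + rV_cons (t : measurableTypeR R, y).
Proof.
apply/rowP => i; rewrite rV_lineE [X in _ * X + _]mxE eqxx /=.
have [k ->|->] := unliftP ord0 i.
  by rewrite !rV_consS rV_lineE mxE /= (inj_eq lift_inj).
by rewrite !rV_cons0 mulr0 add0r.
Qed.

Lemma continuous_rV_cons (R : realType) (n : nat) (t : R) :
  continuous (fun y : 'rV[R]_n => rV_cons (t : measurableTypeR R, y)).
Proof.
move=> y A /= /(nbhs_ballP (rV_cons (t, y))) [e e0 eA].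
apply/(nbhs_ballP y); exists e => // z [_ yz]; apply: eA; split => // a i; rewrite ord1.
have [j ->|->] := unliftP ord0 i; first by rewrite !rV_consS; exact: yz.
by rewrite !rV_cons0; exact: ballxx.
Qed.

Lemma compact_rV_box (R : realType) (n : nat) (a b : 'rV[R]_n) :
  compact (rV_box a b).
Proof.
rewrite (_ : rV_box a b =
    [set x | forall i, `[a ord0 i, b ord0 i]%classic (x ord0 i)]).
  apply: (@rV_compact R n (fun i => `[a ord0 i, b ord0 i]%classic)) => i.
  exact: segment_compact.
by apply/seteqP; split => x /= + i => /(_ i); rewrite in_itv.
Qed.

Lemma bounded_support_integrable (R : realType) (n : nat) (f : 'rV[R]_n -> R)
    (K : R) : continuous f ->
  (forall x : 'rV[R]_n, (exists j, K < `|x ord0 j|) -> f x = 0) ->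
  (lebesgue_rV n).-integrable setT (EFin \o f).
Proof.
move=> cf f0; pose B := rV_box (const_mx (- `|K|)) (const_mx `|K|) : set 'rV[R]_n.
have mB : measurable B by exact: measurable_rV_box.
have fB : f = f \_ B.
  apply/funext => x; rewrite patchE; case: ifPn => // xB; apply: f0.
  apply: contrapT => h; move/negP: xB; apply; rewrite inE => j.
  rewrite !mxE -ler_norml leNgt; apply/negP => Kx; apply: h; exists j.
  exact: le_lt_trans (ler_norm _) Kx.
rewrite fB -restrict_EFin.
apply: (iffLR (@integrable_mkcond _ _ _ (lebesgue_rV n) _ _ mB)).
have cB : compact B by exact: compact_rV_box.
have /ex_strict_bound_gt0[M M0 fM] : bounded_set (f @` B).
  by apply: compact_bounded; apply: continuous_compact => //; exact: continuous_subspaceT.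
have Boo : (lebesgue_rV n B < +oo)%E.
  rewrite lebesgue_rV_box ?ltry// => i.
  by rewrite !mxE (le_trans (y := 0)) ?oppr_le0.
apply: measurable_bounded_integrable => //.
- by apply: measurable_funTS; exact: continuous_measurable_rV.
- exists M; split; first exact: num_real.
  move=> M' MM' x Bx /=; apply/ltW/(lt_trans _ MM'); apply: fM; exact: imageP.
Qed.

(** Peels off the first coordinate, so that Fubini applies to the recursively
  defined Lebesgue measure. *)
Lemma integral_rVS (R : realType) (n : nat) (f : 'rV[R]_n.+1 -> \bar R) :
  (lebesgue_rV n.+1).-integrable setT f ->
  (@lebesgue_measure R \x lebesgue_rV n)%E.-integrable setT (f \o @rV_cons R n) /\
  (\int[lebesgue_rV n.+1]_x f x =
   \int[@lebesgue_measure R \x lebesgue_rV n]_z f (rV_cons z))%E.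
Proof.
move=> /integrableP[mf fi].
have mc := @measurable_rV_cons R n.
have ii : (@lebesgue_measure R \x lebesgue_rV n)%E.-integrable setT (f \o @rV_cons R n).
  apply/integrableP; split; first exact: measurableT_comp.
  move: fi; rewrite /= (@ge0_integral_pushforward _ _ _ _ _ (@rV_cons R n))//.
  exact: measurableT_comp.
split => //.
by rewrite /= (@integral_pushforward _ _ _ _ _ (@rV_cons R n)).
Qed.

(** Fubini lets the variable [i] be integrated first, where the fundamental theorem
  of calculus yields 0. If [i] is the first coordinate, this is done directly;
  otherwise the first coordinate is frozen and the induction hypothesis applies
  to the slice. *)
Lemma integral_partial_compact_support (R : realType) (n : nat) (i : 'I_n)
    (g dg : 'rV[R]_n -> R) (K : R) :
  (forall x, is_derive x (delta_mx ord0 i) g (dg x)) -> continuous dg ->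
  (forall x : 'rV[R]_n, (exists j, K < `|x ord0 j|) -> g x = 0 /\ dg x = 0) ->
  (\int[lebesgue_rV n]_x (dg x)%:E = 0)%E.
Proof.
elim: n i g dg => [[]//|n IHn] i g dg dgE cdg g0.
have /integral_rVS[ii ->] : (lebesgue_rV n.+1).-integrable setT (EFin \o dg).
  by apply: (@bounded_support_integrable _ _ _ K) => // x /g0[].
have [j ij|ij] := unliftP ord0 i.
- rewrite -integral12_prod_meas1// integral0_eq// => t _.
  apply: (IHn j (fun y => g (rV_cons (t, y))) (fun y => dg (rV_cons (t, y)))).
  + move=> y; have := dgE (rV_cons (t, y)); rewrite ij.
    move=> /is_derive_line0 h; apply/is_derive_line0.
    rewrite (_ : (fun s => _) = (fun s => g (s *: delta_mx ord0 (lift ord0 j) +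
      rV_cons (t, y))))//.
    by apply/funext => s; rewrite rV_cons_delta.
  + move=> y; apply: (@continuous_comp _ _ _ (fun y => rV_cons (t, y)) dg).
      exact: continuous_rV_cons.
    exact: cdg.
  + move=> y [k Kk]; apply: g0; exists (lift ord0 k).
    by rewrite rV_consS.
- rewrite -integral21_prod_meas1// integral0_eq// => y _.
  apply: (@integral_derive_compact_support _ (fun t => g (rV_cons (t, y))) _ K).
  + move=> t.
    rewrite (_ : (fun t => _) = (fun s => g (s *: delta_mx ord0 ord0 +
      rV_cons (0 : measurableTypeR R, y)))); last first.
      by apply/funext => s; rewrite rV_cons_line.
    apply/is_derive_line; rewrite -rV_cons_line -ij; exact: dgE.
  + pose phi (s : R) : 'rV[R]_n.+1 :=
      s *: delta_mx ord0 ord0 + rV_cons (0 : measurableTypeR R, y).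
    rewrite (_ : (fun t => _) = dg \o phi); last first.
      by apply/funext => s; congr (dg _); exact: rV_cons_line.
    move=> t; apply: continuous_comp; last exact: cdg.
    apply: cvgD; last exact: cvg_cst.
    exact: scalel_continuous.
  + by move=> t Kt; apply: g0; exists ord0; rewrite rV_cons0.
Qed.

(** * Integrability of Gaussians *)

(** Up to its normalising constant, the integrand is the density of the normal
  distribution with variance [1 / (2 c)]. *)
Lemma integrable_gauss (R : realType) (c a : R) : 0 < c ->
  (@lebesgue_measure R).-integrable setT
    (fun t => (expR (- (c * (t - a) ^+ 2)))%:E).
Proof.
move=> c0; pose s : R := Num.sqrt (2 * c)^-1.
have s0 : 0 < s by rewrite sqrtr_gt0 invr_gt0 mulr_gt0.
have /(integrableZl measurableT (normal_peak s)^-1) := integrable_normal_pdf a s.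
apply: eq_integrable => // t _.
rewrite -EFinM /normal_pdf gt_eqF// mulKf ?gt_eqF ?normal_peak_gt0 ?gt_eqF//.
rewrite /normal_fun sqr_sqrtr ?invr_ge0 ?mulr_ge0 ?ltW//.
congr (expR _)%:E; rewrite mulNr; congr (- _); rewrite mulrC; congr (_ * _).
by rewrite -mulr_natl invfM invrK mulKf.
Qed.

Lemma enorm_sqr (R : realType) (n : nat) (x : 'rV[R]_n) :
  enorm x ^+ 2 = \sum_i x ord0 i ^+ 2.
Proof. by rewrite sqr_sqrtr// sumr_ge0// => i _; exact: sqr_ge0. Qed.

Section continuous_real.
Context {R : realType} {T : topologicalType}.
Implicit Types f g : T -> R.

Lemma continuous_cstf (c : R) : continuous (fun _ : T => c).
Proof. by move=> x; exact: cvg_cst. Qed.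

Lemma continuous_addf f g : continuous f -> continuous g ->
  continuous (fun x => f x + g x).
Proof. by move=> cf cg x; apply: cvgD; [exact: cf|exact: cg]. Qed.

Lemma continuous_oppf f : continuous f -> continuous (fun x => - f x).
Proof. by move=> cf x; apply: cvgN; exact: cf. Qed.

Lemma continuous_mulf f g : continuous f -> continuous g ->
  continuous (fun x => f x * g x).
Proof. by move=> cf cg x; apply: cvgM; [exact: cf|exact: cg]. Qed.

Lemma continuous_expf f n : continuous f -> continuous (fun x => f x ^+ n).
Proof.
move=> cf; elim: n => [|n IHn]; first exact: continuous_cstf.
rewrite (_ : (fun x => _) = fun x => f x * f x ^+ n); first exact: continuous_mulf.
by apply/funext => x; rewrite exprS.
Qed.

Lemma continuous_invf f : continuous f -> (forall x, f x != 0) ->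
  continuous (fun x => (f x)^-1).
Proof. by move=> cf f0 x; apply: cvgV => //; exact: cf. Qed.

Lemma continuous_compf (h : R -> R) f : continuous h -> continuous f ->
  continuous (fun x => h (f x)).
Proof. by move=> ch cf x; apply: continuous_comp; [exact: cf|exact: ch]. Qed.

Lemma continuous_sumf n (f : 'I_n -> T -> R) : (forall i, continuous (f i)) ->
  continuous (fun x => \sum_i f i x).
Proof.
move=> cf; elim: (index_enum _) => [|i s IHs].
  rewrite (_ : (fun x => _) = fun=> 0); first exact: continuous_cstf.
  by apply/funext => x; rewrite big_nil.
rewrite (_ : (fun x => _) = fun x => f i x + \sum_(i <- s) f i x).
  exact: continuous_addf.
by apply/funext => x; rewrite big_cons.
Qed.

End continuous_real.

Lemma continuous_coor (R : realType) (n : nat) (i : 'I_n) :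
  continuous (fun x : 'rV[R]_n => x ord0 i).
Proof. exact: coord_continuous. Qed.

Lemma continuous_sqr_enorm (R : realType) (n : nat) (xa : 'rV[R]_n) :
  continuous (fun x : 'rV[R]_n => enorm (x - xa) ^+ 2).
Proof.
rewrite (_ : (fun x => _) = fun x : 'rV[R]_n => \sum_i (x ord0 i - xa ord0 i) ^+ 2).
  by apply: continuous_sumf => i; apply: continuous_expf; apply: continuous_addf;
    [exact: continuous_coor|exact: continuous_cstf].
by apply/funext => x; rewrite enorm_sqr; apply: eq_bigr => i _; rewrite !mxE.
Qed.

Lemma measurable_gaussian (R : realType) (n : nat) (c : R) (xa : 'rV[R]_n) :
  measurable_fun setT (fun x : 'rV[R]_n => expR (- (c * enorm (x - xa) ^+ 2))).
Proof.
apply: continuous_measurable_rV; apply: (continuous_compf (@continuous_expR R)).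
apply: continuous_oppf; apply: continuous_mulf; first exact: continuous_cstf.
exact: continuous_sqr_enorm.
Qed.

(** By Tonelli, the integral factors into one-dimensional ones. *)
Lemma integral_gaussian_lty (R : realType) (n : nat) (c : R) (xa : 'rV[R]_n) :
  0 < c ->
  (\int[lebesgue_rV n]_x (expR (- (c * enorm (x - xa) ^+ 2)))%:E < +oo)%E.
Proof.
move=> c0; elim: n xa => [|n IHn] xa.
  rewrite integral_dirac ?diracT ?mul1e ?ltry//.
  by apply/measurable_EFinP; exact: (@measurable_gaussian R 0 c xa).
have mg := @measurable_gaussian R n.+1 c xa.
have mc := @measurable_rV_cons R n.
rewrite /= (@ge0_integral_pushforward _ _ _ _ _ (@rV_cons R n))//; last first.
  by apply/measurable_EFinP; exact: mg.
pose x' := (rV_uncons xa).2; pose a := xa ord0 ord0.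
rewrite preimage_setT fubini_tonelli1; last 2 first.
- by apply/measurable_EFinP; exact: (measurableT_comp mg mc).
- by move=> x; rewrite lee_fin expR_ge0.
pose I := (\int[lebesgue_rV n]_x (expR (- (c * enorm (x - x') ^+ 2)))%:E)%E.
have I0 : (0 <= I)%E by apply: integral_ge0 => x _; rewrite lee_fin expR_ge0.
have /integrableP[mG Goo] := integrable_gauss a c0.
have G0 (t : R) : (0 <= (expR (- (c * (t - a) ^+ 2)))%:E)%E.
  by rewrite lee_fin expR_ge0.
rewrite /fubini_F (@eq_integral _ _ _ (@lebesgue_measure R) setT
  (fun t : measurableTypeR R => (expR (- (c * (t - a) ^+ 2)))%:E * I)%E).
  rewrite ge0_integralZr//; apply: lte_mul_pinfty => //; first exact: integral_ge0.
    rewrite ge0_fin_numE; last exact: integral_ge0.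
    apply: le_lt_trans Goo; rewrite le_eqVlt; apply/orP; left; apply/eqP.
    by apply: eq_integral => t _; rewrite gee0_abs.
  exact: IHn.
move=> t _; rewrite /I -ge0_integralZl//; last first.
  by apply/measurable_EFinP; exact: measurable_gaussian.
apply: eq_integral => y _ /=; rewrite -EFinM -expRD; congr (expR _)%:E.
rewrite !enorm_sqr big_ord_recl mulrDr opprD.
have E (v u : 'rV[R]_n.+1) i : (v - u) ord0 i = v ord0 i - u ord0 i by rewrite !mxE.
have E' (v u : 'rV[R]_n) i : (v - u) ord0 i = v ord0 i - u ord0 i by rewrite !mxE.
rewrite E rV_cons0; congr (_ - c * _); apply: eq_bigr => i _.
by rewrite E rV_consS E' /= -[xa in LHS]rV_unconsK rV_consS.
Qed.

(** * Differentiation rules and a cutoff function *)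

Section derivative_rules.
Context {R : realType} {n : nat}.
Implicit Types (f g : 'rV[R]_n -> R) (x v : 'rV[R]_n).

Lemma is_derive_mul f g x v (df dg : R) :
  is_derive x v f df -> is_derive x v g dg ->
  is_derive x v (fun y => f y * g y) (f x * dg + g x * df).
Proof. exact: is_deriveM. Qed.

Lemma is_derive_add f g x v (df dg : R) :
  is_derive x v f df -> is_derive x v g dg ->
  is_derive x v (fun y => f y + g y) (df + dg).
Proof. exact: is_deriveD. Qed.

Lemma is_derive_cst_mul (c : R) f x v (df : R) :
  is_derive x v f df -> is_derive x v (fun y => c * f y) (c * df).
Proof. exact: is_deriveZ. Qed.

Lemma is_derive_coor_sub (xa : 'rV[R]_n) (i : 'I_n) x :
  is_derive x (delta_mx ord0 i) (fun y : 'rV[R]_n => (y - xa) ord0 i) (1 : R).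
Proof.
have := is_derive_add (is_derive_coor i i x)
  (is_derive_cst (- xa ord0 i) x (delta_mx ord0 i)).
rewrite eqxx addr0; congr (is_derive _ _ _ _).
by apply/funext => y; rewrite !mxE.
Qed.

Lemma is_derive_comp_line (phi : R -> R) f x v (a b : R) :
  is_derive (f x) (1 : R) phi a -> is_derive x v f b ->
  is_derive x v (fun y => phi (f y)) (a * b).
Proof.
move=> dphi /is_derive_line0 df; apply/is_derive_line0.
apply: (@is_derive1_comp _ phi (fun s : R => f (s *: v + x))) => //.
by rewrite scale0r add0r.
Qed.

End derivative_rules.

(** The derivative [2 * max 0 t] is 2-Lipschitz, so the first-order Taylor
  remainder is at most [h ^+ 2] whatever the signs of [t] and [t + h]; no separate
  treatment of the kink at 0 is needed. *)
Lemma is_derive_sqr_max0 (R : realType) (t : R) :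
  is_derive t (1 : R) (fun s : R => Num.max 0 s ^+ 2) (2 * Num.max 0 t).
Proof.
pose phi (s : R) := Num.max 0 s ^+ 2.
have remainder (h : R) : `|phi (h + t) - phi t - h * (2 * Num.max 0 t)| <= h ^+ 2.
  rewrite /phi ler_norml; case: (leP 0 t) => t0; case: (leP 0 (h + t)) => ht0;
    apply/andP; split; nra.
suff H : (fun h : R => h^-1 *: ((phi \o shift t) (h *: (1 : R)) - phi t)) @ 0^' -->
    2 * Num.max 0 t.
  by split; [apply/cvg_ex; exists (2 * Num.max 0 t)|exact/cvg_lim].
apply/cvgrPdist_le => e e0; near=> h.
have h0 : h != 0 by near: h; exact: nbhs_dnbhs_neq.
have he : `|h| <= e.
  by near: h; exact: dnbhs0_le.
apply: le_trans he; rewrite /= -[h *: 1]/(h * 1) mulr1.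
rewrite -(ler_pM2l (x := `|h|)) ?normr_gt0// -normrM mulrBr -[h^-1 *: _]/(h^-1 * _).
by rewrite mulVKf// distrC -expr2 real_normK ?num_real.
Unshelve. all: by end_near. Qed.

(** The cutoff used below is the square of this function: the square is of class
  C^1, and its gradient carries a factor [cutoff_base], which can be absorbed by
  the energy term weighted by [cutoff_base ^+ 2]. *)
Definition cutoff_base (R : realType) (n : nat) (xa : 'rV[R]_n) (K : R)
    (x : 'rV[R]_n) : R := Num.max 0 (1 - enorm (x - xa) ^+ 2 / K ^+ 2).

Lemma is_derive_cutoff (R : realType) (n : nat) (xa : 'rV[R]_n) (K : R)
    (x : 'rV[R]_n) (i : 'I_n) :
  is_derive x (delta_mx ord0 i) (fun y => cutoff_base xa K y ^+ 2)
    (- (4 * cutoff_base xa K x * (x - xa) ord0 i / K ^+ 2)).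
Proof.
have d0 : is_derive x (delta_mx ord0 i : 'rV[R]_n)
    (fun y => enorm (y - xa) ^+ 2) (2 * (x - xa) ord0 i).
  (* The effective potential of [V = 0] with [alpha = 2] is [|y - xa| ^+ 2]. *)
  have := @is_derive_V_tilde R n 2 (cst 0) xa i x (derivable_cst _ _ _).
  have -> : V_tilde 2 (cst 0) xa = (fun y => enorm (y - xa) ^+ 2).
    by apply/funext => y; rewrite /V_tilde /cst add0r divff// mul1r.
  by rewrite /partial derive_cst add0r.
pose phi (s : R) := Num.max 0 (1 - s / K ^+ 2) ^+ 2.
have dphi (s : R) : is_derive s (1 : R) phi
    (2 * Num.max 0 (1 - s / K ^+ 2) * (- (K ^+ 2)^-1)).
  apply: (@is_derive1_comp _ (fun s : R => Num.max 0 s ^+ 2)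
    (fun s : R => 1 - s / K ^+ 2)).
    exact: is_derive_sqr_max0.
  have -> : (fun s : R => 1 - s / K ^+ 2) = cst 1 - (K ^+ 2)^-1 *: id.
    by apply/funext => r; rewrite !fctE /= mulrC.
  by apply: is_derive_eq; rewrite sub0r -[_ *: 1]/(_ * 1) mulr1.
have := is_derive_comp_line (dphi _) d0.
rewrite /cutoff_base; set u := Num.max 0 _.
move=> H; suff -> : - (4 * u * (x - xa) ord0 i / K ^+ 2) =
  2 * u * - (K ^+ 2)^-1 * (2 * (x - xa) ord0 i) by exact: H.
ring.
Qed.

Lemma continuous_cutoff_base (R : realType) (n : nat) (xa : 'rV[R]_n) (K : R) :
  continuous (cutoff_base xa K).
Proof.
have cm : continuous (fun s : R => Num.max 0 s).
  move=> s; apply: continuous_max; [exact: cvg_cst|exact: cvg_id].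
apply: (continuous_compf cm); apply: continuous_addf; first exact: continuous_cstf.
apply: continuous_oppf; apply: continuous_mulf; last exact: continuous_cstf.
exact: continuous_sqr_enorm.
Qed.

Lemma cutoff_base_support (R : realType) (n : nat) (xa : 'rV[R]_n) (K : R)
    (x : 'rV[R]_n) : 0 < K ->
  (exists j, K + \sum_k `|xa ord0 k| < `|x ord0 j|) -> cutoff_base xa K x = 0.
Proof.
move=> K0 [j Kj]; apply/max_idPl; rewrite subr_le0 ler_pdivlMr ?exprn_gt0// mul1r.
have Kd : K <= `|(x - xa) ord0 j|.
  rewrite !mxE; apply: le_trans (lerB_dist _ _); rewrite lerBrDr; apply/ltW.
  apply: le_lt_trans Kj; rewrite lerD2l (bigD1 j)//= lerDl sumr_ge0//.
rewrite enorm_sqr (bigD1 j)//= -[X in X <= _]addr0 lerD//; last first.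
  by apply: sumr_ge0 => k _; exact: sqr_ge0.
by rewrite -[leRHS]real_normK ?num_real// lerXn2r// ?nnegrE// ltW.
Qed.

(** * The energy estimate *)

(** Integrate the divergence of [m ^+ 2 * h * J] with [m] the cutoff. As
  [div J = 0] and [grad h = - a J], the result is minus the weighted energy plus a
  cross term [grad (m ^+ 2) . (h J)], which Young's inequality splits into half of
  the energy and a remainder of order [h ^+ 2 / (a * K ^+ 2)]. The last hypothesis
  bounds this remainder by a multiple of [w], so its integral is controlled by the
  total mass of [w], uniformly in everything but [K]. *)
Lemma caccioppoli_estimate (R : realType) (n : nat) (w a h : 'rV[R]_n -> R)
    (J dJ : 'I_n -> 'rV[R]_n -> R) (nu K : R) (xa : 'rV[R]_n) :
  0 < K -> 0 <= nu ->
  continuous w -> (forall x, 0 <= w x) ->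
  (lebesgue_rV n).-integrable setT (EFin \o w) ->
  continuous a -> (forall x, 0 < a x) -> continuous h ->
  (forall i x, is_derive x (delta_mx ord0 i) h (- (a x * J i x))) ->
  (forall i, continuous (J i)) -> (forall i, continuous (dJ i)) ->
  (forall i x, is_derive x (delta_mx ord0 i) (J i) (dJ i x)) ->
  (forall x, \sum_i dJ i x = 0) ->
  (forall x, h x ^+ 2 <= nu * w x * a x) ->
  (\int[lebesgue_rV n]_x (cutoff_base xa K x ^+ 2 * (a x * \sum_i J i x ^+ 2)) <=
   16 * nu / K ^+ 2 * \int[lebesgue_rV n]_x w x)%R.
Proof.
move=> K0 nu0 cw w0 iw ca a0 ch dh cJ cdJ ddJ divJ hwa.
pose mu := @lebesgue_rV R n.
pose m := cutoff_base xa K.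
have cm : continuous m by exact: continuous_cutoff_base.
have m0 (x : 'rV[R]_n) : (exists j, K + \sum_k `|xa ord0 k| < `|x ord0 j|) ->
    m x = 0 by exact: cutoff_base_support.
pose flux i x := m x ^+ 2 * (h x * J i x).
pose dflux i x := m x ^+ 2 * (h x * dJ i x + J i x * - (a x * J i x)) +
  h x * J i x * - (4 * m x * (x - xa) ord0 i / K ^+ 2).
have cd i : continuous (fun x : 'rV[R]_n => (x - xa) ord0 i).
  rewrite (_ : (fun x => _) = fun x : 'rV[R]_n => x ord0 i - xa ord0 i).
    by apply: continuous_addf; [exact: continuous_coor|exact: continuous_cstf].
  by apply/funext => x; rewrite !mxE.
have cdflux i : continuous (dflux i).
  apply: continuous_addf; apply: continuous_mulf.
  - exact: continuous_expf.
  - apply: continuous_addf; first exact: continuous_mulf.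
    by apply: continuous_mulf => //; apply: continuous_oppf; exact: continuous_mulf.
  - exact: continuous_mulf.
  - apply: continuous_oppf; apply: continuous_mulf; last exact: continuous_cstf.
    by apply: continuous_mulf => //; apply: continuous_mulf => //; exact: continuous_cstf.
have dflux0 i (x : 'rV[R]_n) :
    (exists j, K + \sum_k `|xa ord0 k| < `|x ord0 j|) -> dflux i x = 0.
  by move=> /m0 mx0; rewrite /dflux mx0 expr0n /= !(mulr0,mul0r) oppr0 mulr0 addr0.
have idflux i : mu.-integrable setT (EFin \o dflux i).
  exact: (bounded_support_integrable (cdflux i) (dflux0 i)).
have int_dflux i : (\int[mu]_x (dflux i x)%:E = 0)%E.
  apply: (@integral_partial_compact_support _ _ i (flux i) _
    (K + \sum_k `|xa ord0 k|)) => //.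
  - move=> x; exact: (is_derive_mul (is_derive_cutoff xa K x i)
      (is_derive_mul (dh i x) (ddJ i x))).
  - by move=> x xK; rewrite dflux0//; split => //; rewrite /flux m0// expr0n mul0r.
pose S x := \sum_i dflux i x.
have iS : mu.-integrable setT (EFin \o S).
  rewrite (_ : EFin \o S = fun x => (\sum_i (dflux i x)%:E)%E).
    by apply: integrable_sum => // i _; exact: idflux.
  by apply/funext => x; rewrite /= /S sumEFin.
have int_S : (\int[mu]_x S x = 0)%R.
  rewrite /Rintegral; under eq_integral do rewrite /S -sumEFin.
  by rewrite integral_sum//= big1// => i _; rewrite int_dflux.
have SE x : S x = - (m x ^+ 2 * (a x * \sum_i J i x ^+ 2)) -
    \sum_i 4 * m x * h x * J i x * (x - xa) ord0 i / K ^+ 2.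
  rewrite /S /dflux.
  have -> : - (m x ^+ 2 * (a x * \sum_i J i x ^+ 2)) =
      \sum_i (m x ^+ 2 * h x * dJ i x - m x ^+ 2 * (a x * J i x ^+ 2)).
    by rewrite big_split /= -mulr_sumr divJ mulr0 add0r sumrN -!mulr_sumr.
  by rewrite -sumrB; apply: eq_bigr => i _; ring.
pose F x := m x ^+ 2 * (a x * \sum_i J i x ^+ 2).
have cF : continuous F.
  apply: continuous_mulf; first exact: continuous_expf.
  by apply: continuous_mulf => //; apply: continuous_sumf => i; exact: continuous_expf.
have iF : mu.-integrable setT (EFin \o F).
  apply: (bounded_support_integrable cF) => x /m0 mx0.
  by rewrite /F mx0 expr0n mul0r.
pose G x := 16 * nu / K ^+ 2 * w x - 2 * S x.
have i1 : mu.-integrable setT (EFin \o (fun x => 16 * nu / K ^+ 2 * w x)).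
  exact: (integrableZl measurableT (16 * nu / K ^+ 2) iw).
have i2 : mu.-integrable setT (EFin \o (fun x => 2 * S x)).
  exact: (integrableZl measurableT 2 iS).
have iG : mu.-integrable setT (EFin \o G) by exact: (integrableB measurableT i1 i2).
have FG x : F x <= G x.
  have -> : G x = F x + (16 * nu / K ^+ 2 * w x +
      (F x + 2 * \sum_i 4 * m x * h x * J i x * (x - xa) ord0 i / K ^+ 2)).
    by rewrite /G SE -/(F x); ring.
  rewrite lerDl.
  (* The remainder only matters where the cutoff is positive, and there
     |x - xa| <= K. *)
  have [mx0|mx0] := eqVneq (m x) 0.
    rewrite /F mx0 expr0n /= mul0r add0r big1 ?mulr0 ?addr0; last first.
      by move=> i _; rewrite !(mulr0, mul0r).
    by rewrite mulr_ge0// mulr_ge0 ?invr_ge0 ?sqr_ge0// mulr_ge0.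
  have dK : \sum_i (x - xa) ord0 i ^+ 2 <= K ^+ 2.
    rewrite -enorm_sqr leNgt; apply/negP => Kd; move/eqP: mx0; apply.
    apply/max_idPl; rewrite subr_le0 ler_pdivlMr ?exprn_gt0// mul1r; exact: ltW.
  (* Completing the square in each coordinate. *)
  have -> : F x + 2 * \sum_i 4 * m x * h x * J i x * (x - xa) ord0 i / K ^+ 2 =
      \sum_i (a x * (m x * J i x + 4 * h x * (x - xa) ord0 i / (K ^+ 2 * a x)) ^+ 2)
      - 16 * h x ^+ 2 / (K ^+ 4 * a x) * \sum_i (x - xa) ord0 i ^+ 2.
    rewrite /F !mulr_sumr -big_split -sumrB /=; apply: eq_bigr => i _.
    by field; rewrite !gt_eqF.
  rewrite addrCA addr_ge0//.
    by apply: sumr_ge0 => i _; rewrite mulr_ge0 ?sqr_ge0// ltW.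
  rewrite subr_ge0; apply: (@le_trans _ _ (16 * h x ^+ 2 / (K ^+ 4 * a x) * K ^+ 2)).
    apply: ler_wpM2l => //.
    apply: divr_ge0; first by rewrite mulr_ge0 ?sqr_ge0.
    by apply/ltW; rewrite mulr_gt0 ?exprn_gt0.
  have -> : 16 * h x ^+ 2 / (K ^+ 4 * a x) * K ^+ 2 = 16 / K ^+ 2 * (h x ^+ 2 / a x).
    by field; rewrite !gt_eqF.
  have -> : 16 * nu / K ^+ 2 * w x = 16 / K ^+ 2 * (nu * w x) by ring.
  apply: ler_wpM2l; first by rewrite divr_ge0 ?sqr_ge0.
  by rewrite ler_pdivrMr.
have := le_Rintegral measurableT iF iG (fun x _ => FG x).
rewrite /G RintegralB// !RintegralZl// int_S mulr0 subr0.
exact.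
Qed.

(** * Vanishing of the flux *)

(** Coordinates are switched on one at a time; each switch moves along a line on
  which [h] has zero derivative. *)
Lemma cst_of_zero_partials (R : realType) (n : nat) (h : 'rV[R]_n -> R) :
  (forall i x, is_derive x (delta_mx ord0 i) h (0 : R)) -> forall x, h x = h 0.
Proof.
move=> dh x; rewrite [x]row_sum_delta.
elim: (index_enum _) => [|i s IHs]; first by rewrite big_nil.
rewrite big_cons -{}IHs; set y := \sum_(j <- s) _.
rewrite -[in RHS](add0r y) -[in RHS](scale0r (delta_mx ord0 i)).
apply: (@is_derive_0_is_cst _ (fun t : R => h (t *: delta_mx ord0 i + y))) => t.
exact/is_derive_line.
Qed.

(** If the flux does not vanish at [x0], the weighted energy [b] is at least [c] on
  a box [B] around [x0], and once [K ^+ 2] exceeds [2 * r] the squared cutoff is at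
  least 1/4 on [B]. The energy integral then stays above
  [c / 4 * e ^+ n], whereas the energy estimate makes it tend to 0 as [K] grows. *)
Lemma flux_eq0_of_finite_mass (R : realType) (n : nat) (w a h : 'rV[R]_n -> R)
    (J dJ : 'I_n -> 'rV[R]_n -> R) (nu : R) :
  0 <= nu ->
  continuous w -> (forall x, 0 <= w x) ->
  (lebesgue_rV n).-integrable setT (EFin \o w) ->
  continuous a -> (forall x, 0 < a x) -> continuous h ->
  (forall i x, is_derive x (delta_mx ord0 i) h (- (a x * J i x))) ->
  (forall i, continuous (J i)) -> (forall i, continuous (dJ i)) ->
  (forall i x, is_derive x (delta_mx ord0 i) (J i) (dJ i x)) ->
  (forall x, \sum_i dJ i x = 0) ->
  (forall x, h x ^+ 2 <= nu * w x * a x) ->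
  forall i x, J i x = 0.
Proof.
move=> nu0 cw w0 iw ca a0 ch dh cJ cdJ ddJ divJ hwa i x0.
apply/eqP; rewrite -[_ == _]negbK; apply/negP => Ji0.
pose b x := a x * \sum_i J i x ^+ 2.
have b_ge0 x : 0 <= b x.
  by rewrite mulr_ge0 ?(ltW (a0 _))// sumr_ge0// => j _; exact: sqr_ge0.
have b0 : 0 < b x0.
  rewrite mulr_gt0// (bigD1 i)//= ltr_pwDl ?exprn_even_gt0//=.
  by apply: sumr_ge0 => j _; exact: sqr_ge0.
have cb : continuous b.
  by apply: continuous_mulf => //; apply: continuous_sumf => j; exact: continuous_expf.
pose c := b x0 / 2; pose r := enorm x0 ^+ 2 + 1.
have c0 : 0 < c by rewrite divr_gt0.
have r0 : 0 < r by rewrite ltr_wpDl ?sqr_ge0.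
have near1 : nbhs x0 [set x | c < b x].
  apply: (cb x0 [set t | c < t]); apply: lt_nbhsr.
  by rewrite /c; lra.
have cE := @continuous_sqr_enorm R n 0.
have near2 : nbhs x0 [set x | enorm (x - 0) ^+ 2 < r].
  apply: (cE x0 [set t | t < r]); apply: lt_nbhsl.
  by rewrite subr0 ltrDl.
have [e /= e0 eB] : exists2 e : R, 0 < e &
    ball x0 e `<=` [set x | c < b x] `&` [set x | enorm (x - 0) ^+ 2 < r].
  by apply/nbhs_ballP; exact: filterI.
pose B := rV_box (x0 - const_mx (e / 2)) (x0 + const_mx (e / 2)).
have mB : measurable B by exact: measurable_rV_box.
have Bball : B `<=` ball x0 e.
  move=> x Bx; split => // k j; rewrite ord1 /ball /=.
  have := Bx j; rewrite !mxE => /andP[h1 h2].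
  by rewrite ltr_distlC; apply/andP; split; lra.
have muB : lebesgue_rV n B = (e ^+ n)%:E.
  rewrite lebesgue_rV_box; last by move=> j; rewrite !mxE; lra.
  under eq_bigr => j _ do rewrite !mxE.
  congr EFin; rewrite (eq_bigr (fun=> e)) ?prodr_const ?card_ord//.
  by move=> j _; lra.
pose M := (\int[lebesgue_rV n]_x w x)%R.
have M0 : 0 <= M by apply: Rintegral_ge0 => x _.
pose beta := c / 4 * e ^+ n.
have beta0 : 0 < beta by rewrite mulr_gt0 ?divr_gt0 ?exprn_gt0.
(* Each summand serves one requirement: K <= K ^+ 2, then 2 * r <= K ^+ 2, and
   finally 16 * nu * M < beta * K ^+ 2, which contradicts the energy estimate. *)
pose K := 1 + 2 * r + 16 * nu * M / beta.
have X0 : 0 <= 16 * nu * M / beta.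
  by apply: divr_ge0; [rewrite mulr_ge0// mulr_ge0|exact: ltW].
have K1 : 1 <= K by rewrite /K; lra.
have K0 : 0 < K by exact: lt_le_trans K1.
have KK : K <= K ^+ 2 by rewrite expr2 ler_peMl// ltW.
have Kr : 2 * r <= K by rewrite /K; lra.
have := caccioppoli_estimate 0 K0 nu0 cw w0 iw ca a0 ch dh cJ cdJ ddJ divJ hwa.
set F := fun x => _ * _; rewrite -/M => FM.
have cF : continuous F.
  by apply: continuous_mulf => //; apply: continuous_expf; exact: continuous_cutoff_base.
have iF : (lebesgue_rV n).-integrable setT (EFin \o F).
  apply: (@bounded_support_integrable _ _ _
    (K + \sum_k `|(0 : 'rV[R]_n) ord0 k|) cF) => x xK.
  by rewrite /F cutoff_base_support// expr0n mul0r.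
have F0 x : 0 <= F x by rewrite mulr_ge0 ?sqr_ge0//; exact: b_ge0.
have Fc x : B x -> c / 4 <= F x.
  move=> /Bball/eB[/= bx rx].
  have m2 : 1 / 2 <= cutoff_base 0 K x.
    rewrite /cutoff_base le_max; apply/orP; right.
    have : enorm (x - 0) ^+ 2 / K ^+ 2 <= 1 / 2.
      rewrite ler_pdivrMr ?exprn_gt0//; lra.
    lra.
  have m4 : 1 / 4 <= cutoff_base 0 K x ^+ 2 by nra.
  have -> : c / 4 = 1 / 4 * c by ring.
  by apply: ler_pM m4 (ltW bx); [lra|exact: ltW].
have mFB : measurable_fun B (fun x => (F x)%:E).
  by apply/measurable_EFinP; apply: measurable_funTS; exact: continuous_measurable_rV.
have betaF : beta <= (\int[lebesgue_rV n]_x F x)%R.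
  rewrite -lee_fin /Rintegral fineK; last exact: integrable_fin_num.
  apply: (@le_trans _ _ (\int[lebesgue_rV n]_(x in B) (F x)%:E)%E).
    rewrite /beta EFinM -muB -integral_cst//; apply: ge0_le_integral => //.
    by move=> x _; rewrite lee_fin divr_ge0// ltW.
  apply: ge0_subset_integral => //.
    by apply/measurable_EFinP; exact: continuous_measurable_rV.
  by move=> x _; rewrite lee_fin.
move: (le_trans betaF FM).
rewrite mulrAC ler_pdivlMr ?exprn_gt0// leNgt => /negP; apply.
apply: (@lt_le_trans _ _ (beta * K)); last by rewrite ler_pM2l.
rewrite -ltr_pdivrMl// /K; lra.
Qed.

(** * The stationary density is the Gibbs density *)

Lemma continuous_V_tilde (R : realType) (n : nat) (alpha : R)
    (V : 'rV[R]_n -> R) (xa : 'rV[R]_n) :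
  continuous V -> continuous (V_tilde alpha V xa).
Proof.
move=> cV; apply: continuous_addf => //; apply: continuous_mulf.
  exact: continuous_cstf.
exact: continuous_sqr_enorm.
Qed.

(** [V] only contributes the factor [exp (- a / nu)]: the decay comes entirely from
  the quadratic part of the effective potential. *)
Lemma integrable_gibbs (R : realType) (n : nat) (alpha nu a : R)
    (V : 'rV[R]_n -> R) (xa : 'rV[R]_n) :
  0 < alpha -> 0 < nu -> continuous V -> (forall x, a <= V x) ->
  (lebesgue_rV n).-integrable setT
    (EFin \o (fun x => expR (- (V_tilde alpha V xa x / nu)))).
Proof.
move=> alpha0 nu0 cV Va; pose c := alpha / 2 / nu.
have c0 : 0 < c by rewrite !divr_gt0.
have cw : continuous (fun x => expR (- (V_tilde alpha V xa x / nu))).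
  apply: (continuous_compf (@continuous_expR R)).
  apply: continuous_oppf; apply: continuous_mulf.
    exact: continuous_V_tilde.
  exact: continuous_cstf.
have ig : (lebesgue_rV n).-integrable setT
    (EFin \o (fun x => expR (- (c * enorm (x - xa) ^+ 2)))).
  apply/integrableP; split.
    by apply/measurable_EFinP; exact: measurable_gaussian.
  apply: le_lt_trans (integral_gaussian_lty xa c0).
  rewrite le_eqVlt; apply/orP; left; apply/eqP; apply: eq_integral => x _.
  by rewrite gee0_abs// lee_fin expR_ge0.
apply: (le_integrable measurableT _ _
  (integrableZl measurableT (expR (- (a / nu))) ig)).
  by apply/measurable_EFinP; exact: continuous_measurable_rV.
move=> x _; rewrite -EFinM /= lee_fin !ger0_norm ?mulr_ge0 ?expR_ge0//.
rewrite -expRD ler_expR -opprD lerN2 /V_tilde mulrDl lerD//.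
  by rewrite ler_pM2r ?invr_gt0.
by rewrite /c mulrAC.
Qed.

(** With [p / w] in place of [h = w / (w + p)], the Young remainder of the energy
  estimate would be [p ^+ 2 / w] up to a constant, whose integral nothing
  controls. For [h] one has [h ^+ 2 = nu * w * k], so that only the total mass of
  [w] enters. *)
Lemma stationary_gibbs (R : realType) (n m : nat) (alpha tau sigma a : R)
    (V : 'rV[R]_n -> R) (xa : 'rV[R]_n) (Sigma : 'M[R]_(n, m))
    (p : 'rV[R]_n -> R) :
  0 < alpha -> alpha * tau < 1 -> 0 < sigma -> class_C 2 V ->
  (forall x, a <= V x) -> Sigma *m Sigma^T = 1%:M ->
  stationary_density (rescaled_sde alpha tau sigma V xa Sigma) p ->
  exists2 C : R, 0 <= C &
    forall x, p x = C * expR (- (V_tilde alpha V xa x / nu_tilde alpha tau sigma)).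
Proof.
move=> alpha0 at1 sigma0 V2 Va SS [p2 p0 _ fp].
pose nu := nu_tilde alpha tau sigma; rewrite -/nu.
have nu0 : 0 < nu by rewrite /nu /nu_tilde divr_gt0 ?exprn_gt0 ?mulr_gt0 ?subr_gt0.
pose w x := expR (- (V_tilde alpha V xa x / nu)).
have cV : continuous V by case: V2.
have cp : continuous p by case: p2.
have w0 x : 0 < w x by exact: expR_gt0.
have cw : continuous w.
  apply: (continuous_compf (@continuous_expR R)).
  apply: continuous_oppf; apply: continuous_mulf.
    exact: continuous_V_tilde.
  exact: continuous_cstf.
pose U i x := partial i V x + alpha * (x - xa) ord0 i.
pose q x := w x + p x.
have q0 x : 0 < q x by rewrite ltr_wpDr.
have cq : continuous q by exact: continuous_addf.
pose h x := w x * (q x)^-1.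
pose k x := w x / (nu * q x ^+ 2).
pose J i x := U i x * p x + nu * partial i p x.
pose dJ i x := (U i x * partial i p x + p x * (partial i (partial i V) x + alpha))
  + nu * partial i (partial i p) x.
have dV i x : derivable V x (delta_mx ord0 i) by case: V2 => _ /(_ i)[].
have dVt i x : is_derive x (delta_mx ord0 i) (V_tilde alpha V xa) (U i x).
  exact: is_derive_V_tilde.
have dp i x : is_derive x (delta_mx ord0 i) p (partial i p x).
  by apply/derivableP; case: p2 => _ /(_ i)[].
have ddp i x : is_derive x (delta_mx ord0 i) (partial i p) (partial i (partial i p) x).
  by apply/derivableP; case: p2 => _ /(_ i)[_ [_ /(_ i)[]]].
have dU i x : is_derive x (delta_mx ord0 i) (U i) (partial i (partial i V) x + alpha).
  have d1 : is_derive x (delta_mx ord0 i) (partial i V) (partial i (partial i V) x).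
    by apply/derivableP; case: V2 => _ /(_ i)[_ [_ /(_ i)[]]].
  have := is_derive_add d1 (is_derive_cst_mul alpha (is_derive_coor_sub xa i x)).
  by rewrite mulr1.
have cdp i : continuous (partial i p) by case: p2 => _ /(_ i)[_ []].
have cddp i : continuous (partial i (partial i p)).
  by case: p2 => _ /(_ i)[_ [_ /(_ i)[_ []]]].
have cdV i : continuous (partial i V) by case: V2 => _ /(_ i)[_ []].
have cddV i : continuous (partial i (partial i V)).
  by case: V2 => _ /(_ i)[_ [_ /(_ i)[_ []]]].
have cU i : continuous (U i).
  apply: continuous_addf => //; apply: continuous_mulf; first exact: continuous_cstf.
  rewrite (_ : (fun x => _) = fun x : 'rV[R]_n => x ord0 i - xa ord0 i).
    by apply: continuous_addf; [exact: continuous_coor|exact: continuous_cstf].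
  by apply/funext => x; rewrite !mxE.
have cJ i : continuous (J i).
  by apply: continuous_addf; apply: continuous_mulf => //; exact: continuous_cstf.
have cdJ i : continuous (dJ i).
  apply: continuous_addf; last by apply: continuous_mulf => //; exact: continuous_cstf.
  apply: continuous_addf; apply: continuous_mulf => //.
  by apply: continuous_addf => //; exact: continuous_cstf.
have dJE i x : is_derive x (delta_mx ord0 i) (J i) (dJ i x).
  exact: (is_derive_add (is_derive_mul (dU i x) (dp i x))
    (is_derive_cst_mul nu (ddp i x))).
have divJ x : \sum_i dJ i x = 0.
  rewrite -[RHS](fp x) fokker_planck_rescaledE// -/nu.
  rewrite mulr_sumr -big_split; apply: eq_bigr => i _ /=; congr (_ + _).
  have -> : partial i (V_tilde alpha V xa) = U i.
    by apply/funext => y; have [_ <-] := dVt i y.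
  by have [_ <-] := is_derive_mul (dU i x) (dp i x).
have dw i x : is_derive x (delta_mx ord0 i) w (- (U i x / nu) * w x).
  pose phi (s : R) := expR (- (s / nu)).
  have dphi (s : R) : is_derive s (1 : R) phi (expR (- (s / nu)) * - nu^-1).
    apply: (@is_derive1_comp _ expR (fun s : R => - (s / nu))).
    have -> : (fun s : R => - (s / nu)) = (- nu^-1) *: id.
      by apply/funext => r; rewrite fctE /= -[_ *: _]/(_ * _) mulNr mulrC.
    by apply: is_derive_eq; rewrite -[_ *: 1]/(_ * 1) mulr1.
  have H := is_derive_comp_line (dphi _) (dVt i x).
  suff -> : - (U i x / nu) * w x =
    expR (- (V_tilde alpha V xa x / nu)) * - nu^-1 * U i x by exact: H.
  by rewrite -/(w x); ring.
have dh i x : is_derive x (delta_mx ord0 i) h (- (k x * J i x)).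
  have dq : is_derive x (delta_mx ord0 i) q (- (U i x / nu) * w x + partial i p x).
    exact: (is_derive_add (dw i x) (dp i x)).
  have dinv : is_derive (q x) (1 : R) (fun s : R => s^-1) (- (q x) ^- 2).
    have : is_derive (q x) (1 : R) (fun s : R => s^-1) (- (id (q x)) ^- 2 *: (1 : R)).
      by apply: (@is_deriveV _ id); rewrite gt_eqF.
    by rewrite -[_ *: 1]/(_ * 1) mulr1.
  have H := is_derive_mul (dw i x) (is_derive_comp_line dinv dq).
  suff -> : - (k x * J i x) =
    w x * (- (q x) ^- 2 * (- (U i x / nu) * w x + partial i p x))
    + (q x)^-1 * (- (U i x / nu) * w x) by exact: H.
  have pq : p x = q x - w x by rewrite /q; ring.
  by rewrite /k /J pq; field; rewrite !gt_eqF.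
have ck : continuous k.
  apply: continuous_mulf => //; apply: continuous_invf.
    by apply: continuous_mulf; [exact: continuous_cstf|exact: continuous_expf].
  by move=> x; rewrite gt_eqF// mulr_gt0// exprn_gt0.
have k0 x : 0 < k x by rewrite divr_gt0// mulr_gt0// exprn_gt0.
have ch : continuous h.
  by apply: continuous_mulf => //; apply: continuous_invf => // x; rewrite gt_eqF.
have hk x : h x ^+ 2 <= nu * w x * k x.
  rewrite le_eqVlt; apply/orP; left; apply/eqP; rewrite /h /k.
  by field; rewrite !gt_eqF.
have J0 : forall i x, J i x = 0.
  apply: (flux_eq0_of_finite_mass (ltW nu0) cw (fun x => ltW (w0 x))
    (integrable_gibbs xa alpha0 nu0 cV Va) ck k0 ch dh cJ cdJ dJE divJ hk).
have hc : forall x, h x = h 0.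
  by apply: cst_of_zero_partials => i x; have := dh i x; rewrite J0 mulr0 oppr0.
exists (p 0 / w 0) => [|x]; first by rewrite divr_ge0// ltW.
have := hc x; rewrite /h => /eqP; rewrite eqr_div ?lt0r_neq0// => /eqP.
rewrite /q !mulrDr [w 0 * w x]mulrC => /addrI wp.
by rewrite -/(w x) mulrAC [p 0 * w x]mulrC wp mulrC mulKf// gt_eqF.
Qed.

(** * Euclidean balls and the ratio of their probabilities *)

Section euclidean_ball.
Context {R : realType} {n : nat}.
Implicit Types (eps : R) (x : 'rV[R]_n).

Lemma eballE x0 eps x : 0 <= eps ->
  (eball x0 eps x) = (enorm (x - x0) ^+ 2 <= eps ^+ 2).
Proof. by move=> eps0; rewrite ler_sqr ?nnegrE ?sqrtr_ge0. Qed.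

Lemma closed_eball (x0 : 'rV[R]_n) eps : 0 <= eps -> closed (eball x0 eps).
Proof.
move=> eps0; have /continuous_closedP := @continuous_sqr_enorm R n x0.
move=> /(_ _ (@closed_le R (eps ^+ 2))); congr closed; apply/seteqP.
by split => x /=; rewrite -?eballE// eballE.
Qed.

Lemma measurable_eball (x0 : 'rV[R]_n) eps : 0 <= eps -> measurable (eball x0 eps).
Proof.
move=> eps0; rewrite -[eball _ _]setCK; apply: measurableC.
by apply: open_measurable_rV; apply: closed_openC; exact: closed_eball.
Qed.

Lemma sub_eball_box (x0 : 'rV[R]_n) eps : 0 <= eps ->
  eball x0 eps `<=` rV_box (x0 - const_mx eps) (x0 + const_mx eps).
Proof.
move=> eps0 x; rewrite /= eballE// enorm_sqr => xe i.
rewrite !mxE -ler_distlC -normrN opprB -ler_sqr ?nnegrE// real_normK ?num_real//.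
apply: le_trans xe; rewrite (bigD1 i)//= !mxE lerDl sumr_ge0// => j _.
exact: sqr_ge0.
Qed.

Lemma compact_eball (x0 : 'rV[R]_n) eps : 0 <= eps -> compact (eball x0 eps).
Proof.
move=> eps0; have cB := @compact_rV_box R n (x0 - const_mx eps) (x0 + const_mx eps).
by apply: subclosed_compact cB _; [exact: closed_eball|exact: sub_eball_box].
Qed.

Lemma eball_center (x0 : 'rV[R]_n) eps : 0 <= eps -> eball x0 eps x0.
Proof.
move=> eps0; rewrite eballE// subrr enorm_sqr big1 ?sqr_ge0// => i _.
by rewrite mxE expr0n.
Qed.

Lemma volume_eball_lty (x0 : 'rV[R]_n) eps : 0 <= eps ->
  (lebesgue_rV n (eball x0 eps) < +oo)%E.
Proof.
move=> eps0; apply: (@le_lt_trans _ _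
    (lebesgue_rV n (rV_box (x0 - const_mx eps) (x0 + const_mx eps)))).
  apply: le_measure; rewrite ?inE; [exact: measurable_eball|exact: measurable_rV_box|].
  exact: sub_eball_box.
by rewrite lebesgue_rV_box ?ltry// => i; rewrite !mxE; lra.
Qed.

(** One ball is a translate of the other. *)
Lemma volume_eball (x0 x1 : 'rV[R]_n) eps : 0 <= eps ->
  lebesgue_rV n (eball x0 eps) = lebesgue_rV n (eball x1 eps).
Proof.
move=> eps0; rewrite -[LHS](lebesgue_rV_translate (x0 - x1)); last first.
  exact: measurable_eball.
congr (lebesgue_rV n _); apply/funext => x; rewrite /eball /=.
by rewrite addrAC addrA subrK.
Qed.

End euclidean_ball.

Lemma max_on_ub (R : realType) (n : nat) (A : set 'rV[R]_n) (f : 'rV[R]_n -> R) :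
  A !=set0 -> compact A -> continuous f -> forall x, A x -> f x <= max_on A f.
Proof.
move=> A0 cA cf x Ax.
have [c /set_mem Ac fc] := EVT_max_rV A0 cA (continuous_subspaceT cf).
have : (f @` A `&` ubound (f @` A)) (max_on A f).
  apply: xgetPex; exists (f c); split; first by exists c.
  by move=> _ [y Ay <-]; apply: fc; exact/mem_set.
by move=> [_]; apply; exists x.
Qed.

Lemma min_on_lb (R : realType) (n : nat) (A : set 'rV[R]_n) (f : 'rV[R]_n -> R) :
  A !=set0 -> compact A -> continuous f -> forall x, A x -> min_on A f <= f x.
Proof.
move=> A0 cA cf x Ax.
have [c /set_mem Ac fc] := EVT_min_rV A0 cA (continuous_subspaceT cf).
have : (f @` A `&` lbound (f @` A)) (min_on A f).
  apply: xgetPex; exists (f c); split; first by exists c.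
  by move=> _ [y Ay <-]; apply: fc; exact/mem_set.
by move=> [_]; apply; exists x.
Qed.

Lemma integrable_cst_fin d (T : measurableType d) (R : realType)
    (mu : {measure set T -> \bar R}) (A : set T) (c : R) :
  measurable A -> (mu A < +oo)%E -> mu.-integrable A (EFin \o cst c).
Proof.
move=> mA muA; apply: measurable_bounded_integrable => //.
by exists `|c|; split; [exact: num_real|move=> M cM x _ /=; exact: ltW].
Qed.
Theorem theorem3 (R : realType) (n m : nat) (alpha tau sigma a eps : R)
    (V : 'rV[R]_n -> R) (xa xb : 'rV[R]_n) (Sigma : 'M[R]_(n, m))
    (p0 : 'rV[R]_n -> R)
    (alpha_gt0 : 0 < alpha) (tau_gt0 : 0 < tau) (alphatau_lt1 : alpha * tau < 1)
    (sigma_gt0 : 0 < sigma)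
    (V_C2 : class_C 2 V) (V_ge : forall x, a <= V x)
    (V_int : (\int[lebesgue_rV n]_x (expR (- V x))%:E < +oo)%E)
    (V_finmin : finite_set [set x | local_min V x])
    (xa_min : local_min V xa)
    (eps_gt0 : 0 < eps)
    (balls_disj : eball xa eps `&` eball xb eps = set0)
    (nm : (n <= m)%N) (SigmaSigmaT : Sigma *m Sigma^T = 1%:M)
    (p0_stat : stationary_density (rescaled_sde alpha tau sigma V xa Sigma) p0) :
  r_c p0 eps xa xb <=
  expR (delta_V V eps xa xb / nu_tilde alpha tau sigma
        + eps ^+ 2 / beta alpha tau sigma ^+ 2
        - min_on (eball xb eps) (fun x => enorm (x - xa) ^+ 2)
          / beta alpha tau sigma ^+ 2).
Proof.
have eps0 := ltW eps_gt0.
have [C C0 pE] := stationary_gibbs alpha_gt0 alphatau_lt1 sigma_gt0 V_C2 V_ge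
  SigmaSigmaT p0_stat.
pose nu := nu_tilde alpha tau sigma.
have at0 : 0 < 1 - alpha * tau by rewrite subr_gt0.
have nu0 : 0 < nu by rewrite /nu /nu_tilde divr_gt0 ?exprn_gt0 ?mulr_gt0.
have cV : continuous V by case: V_C2.
pose mu := @lebesgue_rV R n.
have nonempty (x : 'rV[R]_n) : eball x eps !=set0 by exists x; exact: eball_center.
pose Ma := max_on (eball xa eps) V + alpha / 2 * eps ^+ 2.
pose D2 := min_on (eball xb eps) (fun x => enorm (x - xa) ^+ 2).
pose mb := min_on (eball xb eps) V + alpha / 2 * D2.
have Vt_a x : eball xa eps x -> V_tilde alpha V xa x <= Ma.
  move=> xe; apply: lerD.
    exact: (max_on_ub (nonempty _) (compact_eball eps0) cV xe).
  by rewrite ler_wpM2l ?divr_ge0 ?(ltW alpha_gt0)// -eballE.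
have Vt_b x : eball xb eps x -> mb <= V_tilde alpha V xa x.
  move=> xe; apply: lerD.
    exact: (min_on_lb (nonempty _) (compact_eball eps0) cV xe).
  rewrite ler_wpM2l ?divr_ge0 ?(ltW alpha_gt0)//.
  exact: (min_on_lb (nonempty _) (compact_eball eps0)
    (@continuous_sqr_enorm R n xa) xe).
have ip A : measurable A -> mu.-integrable A (EFin \o p0).
  move=> mA; apply: (integrableS measurableT mA) => //.
  have := integrableZl measurableT C (integrable_gibbs xa alpha_gt0 nu0 cV V_ge).
  by apply: eq_integrable => // x _; rewrite /= pE.
pose vol := fine (mu (eball xb eps)).
have vol0 : 0 <= vol by exact: fine_ge0.
have mball (x : 'rV[R]_n) : measurable (eball x eps) by exact: measurable_eball.
have icst (x : 'rV[R]_n) c : mu.-integrable (eball x eps) (EFin \o cst c).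
  by apply: integrable_cst_fin => //; exact: volume_eball_lty.
have Pb : prob p0 (eball xb eps) <= C * expR (- (mb / nu)) * vol.
  rewrite /prob /vol -Rintegral_cst//; apply: le_Rintegral => //.
  - exact: ip.
  - exact: icst.
  move=> x xe; rewrite pE /= ler_wpM2l// ler_expR lerN2 ler_pM2r ?invr_gt0//.
  exact: Vt_b.
have Pa : C * expR (- (Ma / nu)) * vol <= prob p0 (eball xa eps).
  rewrite /vol (volume_eball xb xa)// /prob -Rintegral_cst//.
  apply: le_Rintegral => //; [exact: icst|exact: ip|].
  move=> x xe; rewrite pE /= ler_wpM2l// ler_expR lerN2 ler_pM2r ?invr_gt0//.
  exact: Vt_a.
have Pa0 : 0 <= prob p0 (eball xa eps).
  by apply: Rintegral_ge0 => x _; rewrite pE mulr_ge0 ?expR_ge0.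
set E := (X in _ <= expR X).
have EE : E = Ma / nu - mb / nu.
  rewrite /E /Ma /mb /delta_V -/D2 -/nu /beta.
  have -> : (sigma / Num.sqrt (alpha * (1 - alpha * tau))) ^+ 2 = 2 * nu / alpha.
    rewrite exprMn exprVn sqr_sqrtr ?mulr_ge0 ?ltW// /nu /nu_tilde.
    by field; rewrite !gt_eqF.
  by field; rewrite !gt_eqF.
have PbPa : prob p0 (eball xb eps) <= expR E * prob p0 (eball xa eps).
  apply: (le_trans Pb); apply: le_trans (ler_wpM2l (expR_ge0 E) Pa).
  rewrite !mulrA [expR E * C]mulrC -[C * expR E * _]mulrA -expRD EE.
  by rewrite addrAC subrr add0r.
rewrite /r_c; move: Pa0; rewrite le_eqVlt => /predU1P[<-|Pa0].
  (* A ratio with denominator 0 is 0 by convention. *)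
  by rewrite invr0 mulr0 expR_ge0.
by rewrite ler_pdivrMr.
Qed.
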